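(* Let $\cong$ be a congruence on LTSs such that $L\doteq L'$ implies $L\cong L'$, and $D\not\cong B$. Then $\cong$ preserves $\mathit{minD}$.
   Context: An LTS is a tuple $L=(S,\Sigma,\Delta,\hat s)$ with states $S$, alphabet $\Sigma$ (possibly infinite), $\tau\notin\Sigma$ a reserved invisible action, transitions $\Delta\subseteq S\times(\Sigma\cup\{\tau\})\times S$, initial state $\hat s$; $\Sigma(L)$ denotes the alphabet. Operators: action prefix $a.L$ ($a\neq\tau$): new initial state $\hat s'$, alphabet $\Sigma\cup\{a\}$, transitions $\Delta\cup\{(\hat s',a,\hat s)\}$. Hiding $L\setminus A$: alphabet $\Sigma\setminus A$, each transition labelled by an element of $A$ relabelled $\tau$, otherwise unchanged. Relational renaming $L\Phi$ ($\Phi$ a set of pairs, $\tau$ not in its domain $\mathcal D(\Phi)$ or range; $\Phi(a,b)$ means $(a,b)\in\Phi$ or $a=b\notin\mathcal D(\Phi)$): alphabet $\{b\mid\exists a\in\Sigma:\Phi(a,b)\}$, transitions $\{(s,b,s')\mid\exists a:(s,a,s')\in\Delta\wedge\Phi(a,b)\}$, same states and initial state. Parallel composition $L_1\|L_2$: states $S_1\times S_2$, alphabet $\Sigma_1\cup\Sigma_2$, initial $(\hat s_1,\hat s_2)$; actions in $\Sigma_1\cap\Sigma_2$ are taken jointly by both components, all other actions (including $\tau$) by one component while the other stays put. A congruence is an equivalence $\cong$ with $L\cong L'\Rightarrow a.L\cong a.L',\ L\setminus A\cong L'\setminus A,\ L\Phi\cong L'\Phi,\ L\|L''\cong L'\|L'',\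 L''\|L\cong L''\|L'$. For $\sigma=a_1\cdots a_n\in\Sigma^*$, $s\stackrel{\sigma}{\Rightarrow}s'$ means a finite path from $s$ to $s'$ whose non-$\tau$ labels are exactly $a_1,\dots,a_n$ in order; $\hat s\stackrel{\xi}{\Rightarrow}$ for $\xi\in\Sigma^\omega$ means an infinite path from $\hat s$ whose non-$\tau$ label sequence is $\xi$; $s\stackrel{\tau^\omega}{\to}$ means an infinite path of $\tau$-transitions from $s$. Define $\mathit{Tr}(L)=\{\sigma\in\Sigma^*\mid\exists s:\hat s\stackrel\sigma\Rightarrow s\}$, $\mathit{Div}(L)=\{\sigma\in\Sigma^*\mid\exists s:\hat s\stackrel\sigma\Rightarrow s\wedge s\stackrel{\tau^\omega}\to\}$, $\mathit{Inf}(L)=\{\xi\in\Sigma^\omega\mid\hat s\stackrel\xi\Rightarrow\}$, $\mathit{Sf}(L)=\{(\sigma,A)\in\Sigma^*\times2^\Sigma\mid\exists s:\hat s\stackrel\sigma\Rightarrow s\wedge\forall a\in A\cup\{\tau\}\,\forall s':(s,a,s')\notin\Delta\}$, and $\mathit{minD}(L)=\{a_1\cdots a_n\in\mathit{Div}(L)\mid\forall i,0\le i<n: a_1\cdots a_i\notin\mathit{Div}(L)\}$ (minimal divergence traces). $L\doteq L'$ (CFFD-equivalence) iff $\Sigma,\mathit{Sf},\mathit{Div},\mathit{Inf}$ all agree on $L$ and $L'$. An equivalence preserves $X$ if $L\cong L'\Rightarrow X(L)=X(L')$. $D$ is the one-state LTS with empty alphabet and no transitions; $B$ is the LTS with empty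 alphabet, states $s_0$ (initial) and $s_1$, and transitions $(s_0,\tau,s_0)$, $(s_0,\tau,s_1)$. *)

(* Defs.v *)
From mathcomp Require Import all_boot.
From mathcomp Require Import boolp classical_sets.

Set Implicit Arguments.
Unset Strict Implicit.
Unset Printing Implicit Defensive.

Local Open Scope classical_set_scope.

(* Visible actions are drawn from an arbitrary type [Act]; a transition label
   is an [option Act], where [None] stands for the invisible action tau and
   [Some a] for the visible action [a].  Thus tau is never in an alphabet. *)
Record lts (Act : Type) := LTS {
  state : Type;
  alphabet : set Act;
  trans : state -> option Act -> state -> Prop;
  init : state;
  trans_alphabet : forall s a s', trans s (Some a) s' -> alphabet a
}.

Section Operators.
Variable Act : Type.
Implicit Types (L : lts Act) (a b : Act) (A : set Act) (F : set (Act * Act)).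

(* The new initial state of a.L is [None]. *)
Inductive prefix_trans a L :
    option (state L) -> option Act -> option (state L) -> Prop :=
  | prefix_first : prefix_trans a None (Some a) (Some (init L))
  | prefix_rest s l s' :
      trans s l s' -> prefix_trans a (Some s) l (Some s').

Lemma prefix_trans_alphabet a L s b s' :
  @prefix_trans a L s (Some b) s' -> (alphabet L `|` [set a]) b.
Proof.
move=> H; inversion H; subst; first by right.
by left; apply: trans_alphabet; eassumption.
Qed.

Definition prefix a L : lts Act :=
  {| state := option (state L);
     alphabet := alphabet L `|` [set a];
     trans := @prefix_trans a L;
     init := None;
     trans_alphabet := @prefix_trans_alphabet a L |}.

Inductive hide_trans L A : state L -> option Act -> state L -> Prop :=
  | hide_hidden s a s' :
      A a -> trans s (Some a) s' -> hide_trans A s None s'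
  | hide_kept s l s' :
      ~ (Some @` A) l -> trans s l s' -> hide_trans A s l s'.

Lemma hide_trans_alphabet L A s a s' :
  @hide_trans L A s (Some a) s' -> (alphabet L `\` A) a.
Proof.
move=> H; inversion H as [|? ? ? nA t]; subst; split.
  by apply: trans_alphabet; exact: t.
by move=> Aa; apply: nA; exists a.
Qed.

Definition hide L A : lts Act :=
  {| state := state L;
     alphabet := alphabet L `\` A;
     trans := @hide_trans L A;
     init := init L;
     trans_alphabet := @hide_trans_alphabet L A |}.

Definition ren_dom F : set Act := [set a | exists b, F (a, b)].

Definition renames F a b : Prop := F (a, b) \/ (a = b /\ ~ ren_dom F a).

Inductive rename_trans L F : state L -> option Act -> state L -> Prop :=
  | rename_tau s s' : trans s None s' -> rename_trans F s None s'
  | rename_act s a b s' :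
      trans s (Some a) s' -> renames F a b -> rename_trans F s (Some b) s'.

Definition rename_alphabet L F : set Act :=
  [set b | exists a, alphabet L a /\ renames F a b].

Lemma rename_trans_alphabet L F s b s' :
  @rename_trans L F s (Some b) s' -> rename_alphabet L F b.
Proof.
move=> H; inversion H as [|? a ? ? t r]; subst; exists a; split=> //.
by apply: trans_alphabet; exact: t.
Qed.

Definition rename L F : lts Act :=
  {| state := state L;
     alphabet := rename_alphabet L F;
     trans := @rename_trans L F;
     init := init L;
     trans_alphabet := @rename_trans_alphabet L F |}.

Inductive par_trans L1 L2 :
    state L1 * state L2 -> option Act -> state L1 * state L2 -> Prop :=
  | par_sync a s1 s1' s2 s2' :
      (alphabet L1 `&` alphabet L2) a ->
      trans s1 (Some a) s1' -> trans s2 (Some a) s2' ->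
      par_trans (s1, s2) (Some a) (s1', s2')
  | par_left l s1 s1' s2 :
      ~ (Some @` (alphabet L1 `&` alphabet L2)) l ->
      trans s1 l s1' -> par_trans (s1, s2) l (s1', s2)
  | par_right l s1 s2 s2' :
      ~ (Some @` (alphabet L1 `&` alphabet L2)) l ->
      trans s2 l s2' -> par_trans (s1, s2) l (s1, s2').

Lemma par_trans_alphabet L1 L2 s a s' :
  @par_trans L1 L2 s (Some a) s' -> (alphabet L1 `|` alphabet L2) a.
Proof.
move=> H; inversion H as [? ? ? ? ? [h _]|? ? ? ? _ t|? ? ? ? _ t]; subst.
- by left.
- by left; apply: trans_alphabet; exact: t.
- by right; apply: trans_alphabet; exact: t.
Qed.

Definition par L1 L2 : lts Act :=
  {| state := state L1 * state L2;
     alphabet := alphabet L1 `|` alphabet L2;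
     trans := @par_trans L1 L2;
     init := (init L1, init L2);
     trans_alphabet := @par_trans_alphabet L1 L2 |}.

End Operators.

Record congruence (Act : Type) (R : lts Act -> lts Act -> Prop) : Prop := {
  cong_refl : forall L, R L L;
  cong_sym : forall L L', R L L' -> R L' L;
  cong_trans : forall L L' L'', R L L' -> R L' L'' -> R L L'';
  cong_prefix : forall a L L', R L L' -> R (prefix a L) (prefix a L');
  cong_hide : forall A L L', R L L' -> R (hide L A) (hide L' A);
  cong_rename : forall F L L', R L L' -> R (rename L F) (rename L' F);
  cong_parl : forall L L' L'', R L L' -> R (par L L'') (par L' L'');
  cong_parr : forall L L' L'', R L L' -> R (par L'' L) (par L'' L')
}.

Definition preserves (Act T : Type) (R : lts Act -> lts Act -> Prop)
    (X : lts Act -> T) : Prop :=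
  forall L L', R L L' -> X L = X L'.

Section Semantics.
Variables (Act : Type) (L : lts Act).
Implicit Types (s : state L) (sigma : seq Act) (xi : nat -> Act).

Inductive weak_path : state L -> seq Act -> state L -> Prop :=
  | weak_nil s : weak_path s [::] s
  | weak_tau s s' sigma s'' :
      trans s None s' -> weak_path s' sigma s'' -> weak_path s sigma s''
  | weak_act s a s' sigma s'' :
      trans s (Some a) s' -> weak_path s' sigma s'' ->
      weak_path s (a :: sigma) s''.

Definition diverges s : Prop :=
  exists p : nat -> state L,
    p 0 = s /\ forall n, trans (p n) None (p n.+1).

(* The strictly increasing [k] enumerates exactly the positions of the path
   that carry a visible label. *)
Definition weak_inf_path s xi : Prop :=
  exists (p : nat -> state L) (l : nat -> option Act) (k : nat -> nat),
    [/\ p 0 = s,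
        forall n, trans (p n) (l n) (p n.+1),
        forall i j, i < j -> k i < k j,
        forall i, l (k i) = Some (xi i) &
        forall n, (exists i, n = k i) \/ l n = None].

(* By [trans_alphabet], the visible labels of a path are in the alphabet, so
   the words below range over the alphabet without an explicit condition. *)
Definition Div : set (seq Act) :=
  [set sigma | exists s, weak_path (init L) sigma s /\ diverges s].

Definition Inf : set (nat -> Act) :=
  [set xi | weak_inf_path (init L) xi].

Definition Sf : set (seq Act * set Act) :=
  [set x | x.2 `<=` alphabet L /\
    exists s, weak_path (init L) x.1 s /\
      forall l, (Some @` x.2 `|` [set None]) l -> forall s', ~ trans s l s'].

Definition minD : set (seq Act) :=
  [set sigma | Div sigma /\
    forall i, i < size sigma -> ~ Div (take i sigma)].

End Semantics.

Definition cffd_equiv (Act : Type) (L L' : lts Act) : Prop :=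
  [/\ alphabet L = alphabet L', Sf L = Sf L', Div L = Div L' & Inf L = Inf L'].

Definition ltsD (Act : Type) : lts Act :=
  {| state := unit;
     alphabet := set0;
     trans := fun _ _ _ => False;
     init := tt;
     trans_alphabet := fun _ _ _ h => False_ind _ h |}.

(* The states s_0 and s_1 are [false] and [true]. *)
Inductive B_trans (Act : Type) : bool -> option Act -> bool -> Prop :=
  | B_loop : B_trans false None false
  | B_stop : B_trans false None true.

Lemma B_trans_alphabet (Act : Type) s (a : Act) s' :
  B_trans s (Some a) s' -> (set0 : set Act) a.
Proof. by move=> H; inversion H. Qed.

Definition ltsB (Act : Type) : lts Act :=
  {| state := bool;
     alphabet := set0;
     trans := @B_trans Act;
     init := false;
     trans_alphabet := @B_trans_alphabet Act |}.

(* Main.v *)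
Require Import Defs.
From Stdlib Require List.
From mathcomp Require Import all_boot.
From mathcomp Require Import boolp classical_sets.

(** Put [L] in parallel with a process that performs the word [w] and stops,
   and hide everything.  The result has empty alphabet, and it can diverge iff
   [L] diverges after some prefix of [w], provided all letters of [w] belong to
   the alphabet of [L].  Without divergence it is CFFD-equivalent to [D].  So if
   [L] and [L'] are related but disagree on divergence along [w], then [D] is
   related to some divergent [X] with empty alphabet.  If [X] can
   deadlock it is CFFD-equivalent to [B]; otherwise [B] ~ [D || B], which is
   related to [X || B] ~ [X], hence to [D].  Both cases contradict the
   assumption on [D] and [B].

   [R] is not assumed to preserve alphabets, so a letter of [w] may be missing
   from the alphabet of [L'].  Prefixing both sides with [w] repairs this: the
   test is run on [w.L] and [w.L'] with the word [ww]. *)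

Set Implicit Arguments.
Unset Strict Implicit.
Unset Printing Implicit Defensive.

Local Open Scope classical_set_scope.

(** * Weak paths, silent divergence and deadlock *)

Section WeakPaths.
Variables (Act : Type) (L : lts Act).
Implicit Types (s : state L) (u v : seq Act).

Lemma weak_path_cat s1 u s2 v s3 :
  weak_path s1 u s2 -> weak_path s2 v s3 -> weak_path s1 (u ++ v) s3.
Proof.
elim=> [s //|s s' w s'' t _ IH /IH|s a s' w s'' t _ IH /IH].
  exact: weak_tau t.
exact: weak_act t.
Qed.

Lemma weak_path_tau1 s s' : trans s None s' -> weak_path s [::] s'.
Proof. by move=> t; apply: weak_tau t (weak_nil _). Qed.

Lemma weak_path_act1 s a s' : trans s (Some a) s' -> weak_path s [:: a] s'.
Proof. by move=> t; apply: weak_act t (weak_nil _). Qed.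

Lemma Div_nil_init : diverges (init L) -> Div L [::].
Proof. by move=> dv; exists (init L); split=> //; exact: weak_nil. Qed.

Lemma Sf_nilE :
  Sf L ([::], set0) <->
  exists2 s, weak_path (init L) [::] s & forall s', ~ trans s None s'.
Proof.
split=> [[_ [s [/= ps dead]]]|[s ps dead]].
  by exists s => // s'; apply: dead; right.
split; first by move=> ? [].
by exists s; split=> // l [[a []]|->].
Qed.

Lemma no_deadlock_Div : ~ Sf L ([::], set0) -> Div L [::].
Proof.
move=> nSf.
(* The reachability premise stands under the existential so that [choice] yields a total successor
   function, to be iterated from [init L]. *)
have next s : exists s', weak_path (init L) [::] s -> trans s None s'.
  apply: contrapT => stuck; apply: nSf; apply/Sf_nilE.
  have ps : weak_path (init L) [::] s.
    by apply: contrapT => nps; apply: stuck; exists s => /nps.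
  by exists s => // s' t; apply: stuck; exists s'.
have [f fP] := choice next.
have reach n : weak_path (init L) [::] (iter n f (init L)).
  elim: n => [|n IH]; first exact: weak_nil.
  exact: (weak_path_cat IH (weak_path_tau1 (fP _ IH))).
by apply: Div_nil_init; exists (fun n => iter n f (init L)); split=> // n; apply: fP.
Qed.

End WeakPaths.

(** * CFFD-equivalence over the empty alphabet *)

Section Silent.
Variable Act : Type.
Implicit Types (L X Y : lts Act).

Lemma silent_path X s u s' :
  alphabet X = set0 -> @weak_path Act X s u s' -> u = [::].
Proof.
by move=> X0; elim=> // s0 a s1 w s2 t; have := trans_alphabet t; rewrite X0.
Qed.

Lemma silent_Inf X : alphabet X = set0 -> Inf X = set0.
Proof.
move=> X0; apply/seteqP; split=> // xi [p [l [k [_ tr _ lk _]]]].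
by have := tr (k 0); rewrite lk => t; have := trans_alphabet t; rewrite X0.
Qed.

Lemma silent_Div_sub X Y :
  alphabet X = set0 -> (Div X [::] -> Div Y [::]) -> Div X `<=` Div Y.
Proof.
move=> X0 XY w [s [ps dv]]; have w0 := silent_path X0 ps.
by rewrite w0; apply: XY; exists s; rewrite -w0.
Qed.

Lemma silent_Sf_sub X Y :
  alphabet X = set0 -> (Sf X ([::], set0) -> Sf Y ([::], set0)) ->
  Sf X `<=` Sf Y.
Proof.
move=> X0 XY [w A] SX; have [/= + [s [ps _]]] := SX.
rewrite X0 subset0 => A0; have w0 := silent_path X0 ps.
by rewrite w0 A0 in SX *; exact: XY.
Qed.

(** Over the empty alphabet only the empty word and the empty refusal set occur, and there are no
    infinite traces. Two bits remain: whether the process can diverge and whether it can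
    deadlock. *)
Lemma silent_cffd X Y :
  alphabet X = set0 -> alphabet Y = set0 ->
  (Div X [::] <-> Div Y [::]) ->
  (Sf X ([::], set0) <-> Sf Y ([::], set0)) -> cffd_equiv X Y.
Proof.
move=> X0 Y0 [dXY dYX] [sXY sYX]; split; first by rewrite X0 Y0.
- by apply/seteqP; split; exact: silent_Sf_sub.
- by apply/seteqP; split; exact: silent_Div_sub.
- by rewrite !silent_Inf.
Qed.

Lemma ltsD_not_Div : ~ Div (ltsD Act) [::].
Proof. by move=> [s [_ [p [_ /(_ 0)]]]]. Qed.

Lemma ltsB_Div : Div (ltsB Act) [::].
Proof.
by apply: Div_nil_init; exists (fun=> false); split=> // n; exact: B_loop.
Qed.

Lemma ltsB_Sf : Sf (ltsB Act) ([::], set0).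
Proof.
apply/Sf_nilE; exists true; last by move=> s' t; inversion t.
by apply: weak_path_tau1; exact: B_stop.
Qed.

(** A process that cannot diverge silently must be able to deadlock, by [no_deadlock_Div], so both
    bits agree with those of [ltsD]. *)
Lemma silent_convergent_cffd_D X :
  alphabet X = set0 -> ~ Div X [::] -> cffd_equiv X (ltsD Act).
Proof.
move=> X0 nX; apply: silent_cffd => //; split.
- by move/nX.
- by move/ltsD_not_Div.
- by move=> _; apply: contrapT => /no_deadlock_Div/ltsD_not_Div.
- by move=> _; apply: contrapT => /no_deadlock_Div.
Qed.

Lemma par_None L1 L2 (x y : state (par L1 L2)) :
  trans x None y <->
  (trans x.1 None y.1 /\ x.2 = y.2) \/ (x.1 = y.1 /\ trans x.2 None y.2).
Proof.
have nS : ~ (Some @` (alphabet L1 `&` alphabet L2)) None by case.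
split=> [t|]; first by inversion t; subst; [left | right].
case: x y => [x1 x2] [y1 y2] /= [[t <-]|[<- t]].
  exact: par_left.
exact: par_right.
Qed.

Lemma par_ltsD_B : cffd_equiv (par (ltsD Act) (ltsB Act)) (ltsB Act).
Proof.
apply: silent_cffd; rewrite //= ?setU0 //; split=> // _.
- exact: ltsB_Div.
- apply: Div_nil_init; exists (fun=> (tt, false)); split=> // n.
  by apply/par_None; right; split=> //; exact: B_loop.
- exact: ltsB_Sf.
- apply/Sf_nilE; exists (tt, true).
    by apply: weak_path_tau1; apply/par_None; right; split=> //; exact: B_stop.
  by move=> s' /par_None [[]|[_ t]] //; inversion t.
Qed.

Lemma par_silent_path L1 L2 (x y : state (par L1 L2)) u :
  weak_path x u y -> u = [::] -> weak_path x.1 [::] y.1.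
Proof.
elim=> // [s|s s' w s'' /par_None [[t _]|[-> _]] _ IH /IH //].
  by move=> _; exact: weak_nil.
exact: weak_tau t.
Qed.

(** Since tau never synchronises, a tau-step of [X] cannot be blocked by [L]. *)
Lemma par_deadlock X L :
  Sf (par X L) ([::], set0) -> Sf X ([::], set0).
Proof.
move=> /Sf_nilE [[s b] /par_silent_path /(_ erefl) ps dead].
apply/Sf_nilE; exists s => // s' t.
by apply: (dead (s', b)); apply/par_None; left.
Qed.

Lemma D_rel_silent_divergent (R : lts Act -> lts Act -> Prop) X :
  congruence R -> (forall L L', cffd_equiv L L' -> R L L') ->
  alphabet X = set0 -> Div X [::] ->
  R (ltsD Act) X -> R (ltsD Act) (ltsB Act).
Proof.
move=> congR cffdR X0 dX DX.
have [sX|nsX] := pselect (Sf X ([::], set0)).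
  apply: (cong_trans congR DX); apply: cffdR; apply: silent_cffd => //.
    by split=> // _; exact: ltsB_Div.
  by split=> // _; exact: ltsB_Sf.
(* Here [X] cannot deadlock, so neither can its composition with [ltsB], which therefore diverges
   just as [X] does. *)
have XB : cffd_equiv (par X (ltsB Act)) X.
  apply: silent_cffd => //=; first by rewrite X0 setU0.
    by split=> // _; apply: no_deadlock_Div => /par_deadlock.
  by split=> [/par_deadlock|].
apply: (cong_trans congR DX); apply: (cong_sym congR).
apply: (cong_trans congR (cong_sym congR (cffdR _ _ par_ltsD_B))).
exact: (cong_trans congR (cong_parl congR _ DX) (cffdR _ _ XB)).
Qed.

End Silent.

(** * Testing for divergence along a word *)

Section Test.
Variable Act : Type.
Implicit Types (L : lts Act) (u v w : seq Act).

Definition word_trans (w : seq Act) (l : option Act) (w' : seq Act) : Prop :=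
  if l is Some a then w = a :: w' else False.

(* The states are the words still to be performed. *)
Definition word_lts w : lts Act :=
  {| state := seq Act;
     alphabet := setT;
     trans := word_trans;
     init := w;
     trans_alphabet := fun _ _ _ _ => I |}.

(** As [word_lts] has the full alphabet, every visible step of [L] must synchronise with it, so [L]
    can perform only prefixes of [w]. *)
Definition test L w : lts Act := Defs.hide (par L (word_lts w)) setT.

Lemma test_alphabet L w : alphabet (test L w) = set0.
Proof. by rewrite /= setDT. Qed.

Lemma test_tau L w s s' v :
  trans s None s' -> @trans _ (test L w) (s, v) None (s', v).
Proof.
by move=> t; apply: hide_kept; [case | apply: par_left => //; case].
Qed.

Lemma test_act L w s a s' v :
  trans s (Some a) s' -> @trans _ (test L w) (s, a :: v) None (s', v).
Proof.
move=> t; apply: (@hide_hidden _ _ _ _ a) => //; apply: par_sync => //.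
by split=> //; exact: (trans_alphabet t).
Qed.

(* When the head of [x.2] is not in the alphabet of [L], the word process
   advances alone. *)
Lemma test_step L w (x y : state (test L w)) :
  List.Forall (alphabet L) x.2 -> trans x None y ->
  (trans x.1 None y.1 /\ x.2 = y.2) \/
  (exists2 a, trans x.1 (Some a) y.1 & x.2 = a :: y.2).
Proof.
move=> xL t; inversion t as [? a ? _ p|? ? ? _ p]; subst.
  inversion p as [? ? ? ? ? _ t1 t2|? ? ? ? nS t1|? ? ? ? nS t2]; subst.
  - by right; exists a.
  - by case: nS; exists a => //; split=> //; exact: (trans_alphabet t1).
  - case: nS; exists a => //; split=> //.
    by rewrite /= t2 in xL; exact: List.Forall_inv xL.
by have [p1|[_ []]] := proj1 (par_None _ _) p; left.
Qed.

Lemma Div_test L w : Div L w -> Div (test L w) [::].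
Proof.
move=> [s [ps [p [p0 tp]]]]; exists (s, [::]); split; last first.
  by exists (fun n => (p n, [::])); rewrite p0; split=> // n; apply: test_tau.
suff lift s0 v s1 :
    weak_path s0 v s1 -> @weak_path _ (test L w) (s0, v) [::] (s1, [::]).
  exact: lift ps.
elim=> [{}s0|{}s0 s' u s'' t _|{}s0 a s' u s'' t _].
- exact: weak_nil.
- by apply: weak_tau; apply: test_tau.
- by apply: weak_tau; apply: test_act.
Qed.

(** Invariant of test runs; it recovers the trace of [L], which hiding erases, from the part of [w]
    already consumed. *)
Definition reached_along L w (x : state (test L w)) : Prop :=
  exists2 u, w = u ++ x.2 & weak_path (init L) u x.1.

Lemma reached_along_step L w (x y : state (test L w)) :
  List.Forall (alphabet L) w -> reached_along x -> trans x None y ->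
  reached_along y.
Proof.
move=> wL [u wE pu] /test_step [].
- by move: wL; rewrite {1}wE => /List.Forall_app [].
- by move=> [t xy]; exists u; rewrite -?xy // -(cats0 u);
    apply: weak_path_cat pu (weak_path_tau1 t).
- move=> [a t xy]; exists (u ++ [:: a]); first by rewrite -catA /= -xy.
  exact: weak_path_cat pu (weak_path_act1 t).
Qed.

Lemma test_Div L w :
  List.Forall (alphabet L) w -> Div (test L w) [::] ->
  exists u v, w = u ++ v /\ Div L u.
Proof.
move=> wL [x [px [p [p0 tp]]]].
have rx : reached_along x.
  have r0 : reached_along (init (test L w)) by exists [::] => //; exact: weak_nil.
  elim: px r0 => // [s s' u s'' t _ IH r0|s a s' u s'' t].
    by apply: IH; exact: reached_along_step r0 t.
  by have := trans_alphabet t; rewrite test_alphabet.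
have rp n : reached_along (p n).
  elim: n => [|n IH]; first by rewrite p0.
  exact: reached_along_step IH (tp n).
(* The [let] term proves that the remaining word, being a suffix of [w], has all its letters in the
   alphabet of [L]. *)
have step n := test_step (let: ex_intro2 u wE _ := rp n in
  proj2 (proj1 (List.Forall_app _ u _) (eq_ind _ (List.Forall _) wL _ wE))) (tp n).
(* Once the remaining word is as short as it ever gets, only tau-steps of [L]
   are left. *)
have [N minN] : exists N, forall n, size (p N).2 <= size (p n).2.
  have ex : exists m, `[< exists n, size (p n).2 = m >].
    by exists (size (p 0).2); apply/asboolP; exists 0.
  case: (ex_minnP ex) => m /asboolP [N <-] minm; exists N => n.
  by apply: minm; apply/asboolP; exists n.
have sizeN n : size (p (N + n)).2 = size (p N).2.
  elim: n => [|n IH]; first by rewrite addn0.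
  (* A synchronised step would shorten the word below its minimal length. *)
  rewrite addnS; have := minN (N + n).+1.
  by case: (step (N + n)) => [[_ <-] //|[a _ xy]]; rewrite -IH xy /= ltnn.
have [u wE pu] := rp N; exists u, (p N).2; split=> //.
exists (p N).1; split=> //; exists (fun n => (p (N + n)).1).
rewrite addn0; split=> // n; rewrite addnS.
case: (step (N + n)) => [[//]|[a _ /(congr1 size)]].
by rewrite sizeN /= -addnS sizeN => /n_Sn.
Qed.

(** * Prefixing a process with a word *)

Definition prefixes L w : lts Act := foldr (@Defs.prefix Act) L w.

Lemma prefixes_alphabet L w : List.Forall (alphabet (prefixes L w)) w.
Proof.
elim: w => [|a w IH]; first exact: List.Forall_nil.
apply: List.Forall_cons; first by right.
by apply: List.Forall_impl IH => b; left.
Qed.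

Lemma prefix_weak_path a L (s s' : state L) u :
  weak_path s u s' -> @weak_path _ (Defs.prefix a L) (Some s) u (Some s').
Proof.
elim=> [{}s|s0 s1 w s2 t _|s0 b s1 w s2 t _].
- exact: weak_nil.
- by apply: weak_tau; exact: prefix_rest.
- by apply: weak_act; exact: prefix_rest.
Qed.

(** No transition of [a.L] enters the new initial state, so a run that has left it stays in [L]. *)
Lemma prefix_weak_path_inv a L (s : state L) x u :
  @weak_path _ (Defs.prefix a L) (Some s) u x ->
  exists2 s', x = Some s' & weak_path s u s'.
Proof.
move: {-1}(Some s) (erefl (Some s)) => y yE p.
elim: p s yE => [{}y|{}y y1 w y2 t _ IH|{}y b y1 w y2 t _ IH] s yE.
- by exists s => //; exact: weak_nil.
- rewrite -yE in t; inversion t as [|? ? s1 t']; subst.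
  by have [s' -> q] := IH _ erefl; exists s' => //; exact: weak_tau q.
- rewrite -yE in t; inversion t as [|? ? s1 t']; subst.
  by have [s' -> q] := IH _ erefl; exists s' => //; exact: weak_act q.
Qed.

Lemma prefix_diverges a L (s : state L) :
  @diverges _ (Defs.prefix a L) (Some s) <-> diverges s.
Proof.
split=> [[p [p0 tp]]|[p [p0 tp]]]; last first.
  exists (fun n => Some (p n)); rewrite p0; split=> // n.
  exact: prefix_rest.
(* The default [s] is never taken: every [p n] is a [Some]. *)
exists (fun n => odflt s (p n)); rewrite p0; split=> // n.
have [s' pn] : exists s', p n = Some s'.
  elim: n => [|n [s' pn]]; first by exists s.
  by have := tp n; rewrite pn => t; inversion t as [|? ? s1]; exists s1.
by have := tp n; rewrite pn => t; inversion t as [|? ? s1].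
Qed.

(** The new initial state has no tau-step, so it does not diverge and every nontrivial run starts
    with [a]. *)
Lemma prefix_Div a L w :
  Div (Defs.prefix a L) w <-> exists2 u, w = a :: u & Div L u.
Proof.
split=> [[x [px dx]]|[u -> [s [ps ds]]]]; last first.
  exists (Some s); split; last exact/prefix_diverges.
  by apply: weak_act (prefix_weak_path a ps); exact: prefix_first.
inversion px as [|? y ? ? t|? b y u ? t p]; subst.
- by case: dx => p [p0 /(_ 0)]; rewrite p0 => t; inversion t.
- by inversion t.
- inversion t; subst; exists u => //.
  have [s xE q] := prefix_weak_path_inv p.
  by rewrite xE in dx; exists s; split=> //; exact: (proj1 (prefix_diverges _ _) dx).
Qed.

Lemma prefixes_Div L w v :
  Div (prefixes L w) v <-> exists2 u, v = w ++ u & Div L u.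
Proof.
elim: w v => [|a w IH] v /=.
  by split=> [dv|[u ->]//]; exists v.
split=> [/prefix_Div [u -> /IH [u' -> du]]|[u -> du]]; first by exists u'.
by apply/prefix_Div; exists (w ++ u) => //; apply/IH; exists u.
Qed.

End Test.

(** * Preservation of minimal divergence traces *)

Section Main.
Variables (Act : Type) (R : lts Act -> lts Act -> Prop).
Hypothesis congR : congruence R.
Hypothesis cffdR : forall L L' : lts Act, cffd_equiv L L' -> R L L'.
Hypothesis DnB : ~ R (ltsD Act) (ltsB Act).

Lemma cong_prefixes w L L' : R L L' -> R (prefixes L w) (prefixes L' w).
Proof. by move=> LL'; elim: w => // a w; exact: cong_prefix. Qed.

Lemma rel_test_Div L L' w :
  R L L' -> Div (test L w) [::] -> Div (test L' w) [::].
Proof.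
move=> LL' dL; apply: contrapT => ndL'; apply: DnB.
apply: (@D_rel_silent_divergent _ _ (test L w)) => //; first exact: test_alphabet.
have tLL' : R (test L w) (test L' w).
  by apply: (cong_hide congR); exact: (cong_parl congR).
apply: (cong_sym congR); apply: (cong_trans congR tLL').
by apply: cffdR; apply: silent_convergent_cffd_D => //; exact: test_alphabet.
Qed.

Lemma rel_Div_prefix L L' w :
  R L L' -> Div L w -> exists2 i, i <= size w & Div L' (take i w).
Proof.
move=> LL' dL.
have : Div (test (prefixes L' w) (w ++ w)) [::].
  apply: rel_test_Div (cong_prefixes w LL') _.
  by apply: Div_test; apply/prefixes_Div; exists w.
case/test_Div; first by apply/List.Forall_app; split; exact: prefixes_alphabet.
move=> x [v [xE /prefixes_Div [u uE du]]].
(* The diverging trace is [w ++ u], a prefix of [w ++ w]; cancelling the first copy of [w] makes [u]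
   a prefix of the second. *)
have wE : w = u ++ v.
  by move/(congr1 (drop (size w))): xE; rewrite uE -catA !drop_size_cat.
by exists (size u); rewrite wE ?size_cat ?leq_addr // take_size_cat.
Qed.

(** A divergence of [L'] at a proper prefix of [w] would, by symmetry, give one of [L] at a prefix
    no longer than that, against minimality. So the prefix of [w] at which [L'] diverges is [w]
    itself. *)
Lemma rel_minD_sub L L' : R L L' -> minD L `<=` minD L'.
Proof.
move=> LL' w [dw minw]; have L'L := cong_sym congR LL'.
have nDiv' i : i < size w -> ~ Div L' (take i w).
  move=> iw /(rel_Div_prefix L'L) [j].
  rewrite (size_takel (ltnW iw)) => ji; rewrite take_takel //.
  exact: minw (leq_ltn_trans ji iw).
split=> //; have [i iw di] := rel_Div_prefix LL' dw.
move: iw; rewrite leq_eqVlt => /predU1P [iE|/nDiv' //].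
by move: di; rewrite iE take_size.
Qed.

End Main.

Theorem theorem6p5 (Act : Type) (R : lts Act -> lts Act -> Prop)
    (congR : congruence R)
    (cffdR : forall L L' : lts Act, cffd_equiv L L' -> R L L')
    (DnB : ~ R (ltsD Act) (ltsB Act)) :
  preserves R (@minD Act).
Proof.
move=> L L' LL'; apply/seteqP; split; first exact: rel_minD_sub LL'.
exact: rel_minD_sub (cong_sym congR LL').
Qed.
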